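(* Let $k\ge 2$ and $n\ge 0$ be even integers. Then $$\sum _{m=1}^{\left\lfloor \sqrt{n}\right\rfloor } (-1)^{m-1}a_k(n-m^2) = \sum _{m=1}^{\left\lfloor \sqrt{n/2}\right\rfloor } (-1)^{m-1}a_k(n-2m^2).$$
   Context: For integers $n\ge 0$ and $k\ge 2$, $a_k(n)$ is the total number of parts divisible by $k$, counted with multiplicity, in all partitions of $n$ in which every part has multiplicity strictly less than $k$. (Writing a partition as $(\lambda_1^{m_1},\ldots,\lambda_\ell^{m_\ell})$ with distinct positive integer parts $\lambda_i$ of multiplicity $m_i\ge1$ and $\sum_i m_i\lambda_i=n$, $a_k(n)$ is the sum over all partitions of $n$ with all $m_i<k$ of $\sum_{i:\,k\mid\lambda_i} m_i$.) Empty sums are $0$. *)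

(* Defs.v *)
From Stdlib Require Import PeanoNat.
From mathcomp Require Import all_boot all_order all_algebra.

Set Implicit Arguments.
Unset Strict Implicit.
Unset Printing Implicit Defensive.

(* A partition mu of n is encoded by its multiplicities: mu i is the number of
   times the part i.+1 occurs. Parts and multiplicities never exceed n. *)
Definition partitions (n : nat) : {set {ffun 'I_n -> 'I_n.+1}} :=
  [set mu : {ffun 'I_n -> 'I_n.+1} | \sum_(i < n) mu i * i.+1 == n].

Definition a (k n : nat) : nat :=
  \sum_(mu in partitions n | [forall i, mu i < k]) \sum_(i < n | k %| i.+1) mu i.

(* Main.v *)
Require Import Defs.
From Stdlib Require Import PeanoNat.
From mathcomp Require Import all_boot all_order all_algebra.
From mathcomp Require Import zify ring.

Set Implicit Arguments.
Unset Strict Implicit.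
Unset Printing Implicit Defensive.

Import GRing.Theory.
Local Open Scope ring_scope.

(** Write A for the generating function of a k, (x; y) for the infinite product
of the factors 1 - x y^i, i >= 0, and
   Q(q) = (q; q^2),   V(q) = (q^2; q^2),   T(q) = 1 + 2 sum_(m >= 1) (-1)^m q^(m^2).
The coefficients of q^n in A(q) T(q) and in A(q) T(q^2) are a k n minus twice the
left, respectively the right side of the theorem. So it is enough that these
two series have the same even part.

Gauss's identity says T(q) = (q; q) Q(q), and (q; q) = Q(q) V(q). Substituting
q^2 for q gives T(q^2) = V(q) Q(q^2) = V(q) Q(q) Q(-q). Hence
   A(q) T(q)   = [A(q) Q(q) V(q)] Q(q),
   A(q) T(q^2) = [A(q) Q(q) V(q)] Q(-q),
and the bracket H is even. Indeed A is a sum, over the multiples j of k, of a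
product of one factor for each possible part i. The factor of an even part is an
even polynomial, and for k even this includes the distinguished part j. The
factor of an odd part i is 1 + q^i + ... + q^((k-1)i), and Q contributes 1 - q^i,
so that together they give 1 - q^(ki), which is even because k is
(parts_gf_odd_qprod_even). Since H is even, H(q) Q(-q) is H(q) Q(q) at -q, so that the
two products have the same coefficients in even degrees (coef_even_comp_NX).

All series are truncated: they are polynomials compared modulo a power of 'X
(eqmodX). Gauss's identity comes from the exact finite identity
   sum_(|j| <= n) (-1)^j q^(j^2) [2n choose n + j]_q = (1 - q)(1 - q^3)...(1 - q^(2n-1))
(gauss_finite), because multiplied by (q; q) the middle Gaussian binomials
become 1 modulo a high power of q (eqmodX_qbin). *)

(** * Polynomials modulo a power of the variable *)

Definition eqmodX {R : nzRingType} (N : nat) (p q : {poly R}) : Prop :=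
  forall i, (i < N)%N -> p`_i = q`_i.

Section Congruence.
Variables (R : comNzRingType) (N : nat).
Implicit Types p q r : {poly R}.

Lemma eqmodX_refl p : eqmodX N p p. Proof. by []. Qed.

Lemma eqmodX_sym p q : eqmodX N p q -> eqmodX N q p.
Proof. by move=> h i /h. Qed.

Lemma eqmodX_trans q p r : eqmodX N p q -> eqmodX N q r -> eqmodX N p r.
Proof. by move=> h1 h2 i iN; rewrite h1 // h2. Qed.

Lemma eqmodXD p p' q q' :
  eqmodX N p p' -> eqmodX N q q' -> eqmodX N (p + q) (p' + q').
Proof. by move=> hp hq i iN; rewrite !coefD hp // hq. Qed.

Lemma eqmodXM p p' q q' :
  eqmodX N p p' -> eqmodX N q q' -> eqmodX N (p * q) (p' * q').
Proof.
move=> hp hq i iN; rewrite !coefM; apply: eq_bigr => j _.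
by rewrite hp ?hq //; have := ltn_ord j; lia.
Qed.

Lemma eqmodX_sum I (r : seq I) (P : pred I) (F G : I -> {poly R}) :
    (forall i, P i -> eqmodX N (F i) (G i)) ->
  eqmodX N (\sum_(i <- r | P i) F i) (\sum_(i <- r | P i) G i).
Proof.
by move=> FG; elim/big_rec2: _ => // i p q Pi h; apply: eqmodXD (FG i Pi) h.
Qed.

Lemma eqmodX_prod I (r : seq I) (P : pred I) (F G : I -> {poly R}) :
    (forall i, P i -> eqmodX N (F i) (G i)) ->
  eqmodX N (\prod_(i <- r | P i) F i) (\prod_(i <- r | P i) G i).
Proof.
by move=> FG; elim/big_rec2: _ => // i p q Pi h; apply: eqmodXM (FG i Pi) h.
Qed.

Lemma eqmodX_sum0 I (r : seq I) (P : pred I) (F : I -> {poly R}) :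
  (forall i, P i -> eqmodX N (F i) 0) -> eqmodX N (\sum_(i <- r | P i) F i) 0.
Proof. by move=> F0; have := eqmodX_sum r F0; rewrite big1_eq. Qed.

Lemma eqmodX_prod1 I (r : seq I) (P : pred I) (F : I -> {poly R}) :
  (forall i, P i -> eqmodX N (F i) 1) -> eqmodX N (\prod_(i <- r | P i) F i) 1.
Proof. by move=> F1; have := eqmodX_prod r F1; rewrite big1_eq. Qed.

Lemma eqmodX_Xn m p : (N <= m)%N -> eqmodX N (p * 'X^m) 0.
Proof. by move=> Nm i iN; rewrite coefMXn coef0; case: ltnP => //; lia. Qed.

Lemma eqmodX_1subXn m : (N <= m)%N -> eqmodX N (1 - 'X^m : {poly R}) 1.
Proof.
move=> Nm i iN; rewrite coefB coefXn.
have /negbTE-> : i != m by lia.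
by rewrite subr0.
Qed.

Lemma eqmodX_prod_widen (F : nat -> {poly R}) m n : (m <= n)%N ->
    (forall i, (m <= i < n)%N -> eqmodX N (F i) 1) ->
  eqmodX N (\prod_(i < n) F i) (\prod_(i < m) F i).
Proof.
move=> mn F1; rewrite -!(big_mkord xpredT) (@big_cat_nat _ _ _ m) //=.
rewrite -[X in eqmodX N _ X]mulr1; apply: eqmodXM => //.
rewrite big_seq; apply: eqmodX_prod1 => i.
by rewrite mem_index_iota; apply: F1.
Qed.

(** A polynomial with constant coefficient 1 is a unit among power series; the
coefficients of q and r are compared one after the other. *)
Lemma eqmodX_cancel p q r :
  p`_0 = 1 -> eqmodX N (p * q) (p * r) -> eqmodX N q r.
Proof.
move=> p0 h i; elim/ltn_ind: i => i IH iN.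
have := h i iN; rewrite !coefM !big_ord_recl p0 !mul1r subn0.
rewrite (eq_bigr (fun j : 'I_i => p`_(lift ord0 j) * r`_(i - lift ord0 j))).
  exact: addIr.
by move=> j _; rewrite IH ?lift0 //; have := ltn_ord j; lia.
Qed.

Lemma eqmodX_comp_Xn p q m : (0 < m)%N ->
  eqmodX N p q -> eqmodX N (p \Po 'X^m) (q \Po 'X^m).
Proof.
move=> m0 h i iN; rewrite !coef_comp_poly_Xn //; case: ifP => // _.
by apply: h; apply: leq_ltn_trans iN; apply: leq_div.
Qed.

End Congruence.

(** * Gaussian binomials and the finite form of Gauss's identity *)

Section GaussianBinomials.
Variable R : comNzRingType.

Fixpoint qbin (m i : nat) : {poly R} :=
  match m, i with
  | _, 0 => 1
  | 0, _.+1 => 0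
  | m'.+1, i'.+1 => qbin m' i' + 'X^i * qbin m' i
  end.

Arguments qbin : simpl never.

(** The q-Pochhammer symbol (q; q)_m, that is (1 - q)^m times the usual q-factorial
of m. *)
Definition qfact (m : nat) : {poly R} := \prod_(i < m) (1 - 'X^(i.+1)).

Lemma qbin0 m : qbin m 0 = 1. Proof. by case: m. Qed.

Lemma qbinS m i : qbin m.+1 i.+1 = qbin m i + 'X^(i.+1) * qbin m i.+1.
Proof. by []. Qed.

Lemma qbin_small m i : (m < i)%N -> qbin m i = 0.
Proof.
elim: m i => [|m IH] [|i] // mi.
by rewrite qbinS !IH ?mulr0 ?addr0 //; lia.
Qed.

(** The second q-Pascal rule, equivalent to the recursive one by the symmetry of
Gaussian binomials. Both rules are applied in gauss_finite. *)
Lemma qbinS_dual m i : (i <= m)%N ->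
  qbin m.+1 i.+1 = 'X^(m - i) * qbin m i + qbin m i.+1.
Proof.
elim: m i => [|m IH] i im.
  have -> : i = 0%N by lia.
  by rewrite qbinS !qbin0 !qbin_small // mulr0 mulr1.
rewrite qbinS; case: (ltnP m i) => [mi|{}im].
  have -> : i = m.+1 by lia.
  by rewrite (@qbin_small m.+1 m.+2) // mulr0 subnn expr0 mul1r.
rewrite [X in _ + _ * X = _](IH i im) [X in _ = _ + X](qbinS m i); case: i im => [|i] im.
  rewrite !qbin0 !subn0 !exprS; ring.
rewrite [X in X + _ = _](IH i) ?[X in _ = _ * X + _](qbinS m i); last by lia.
have -> : (m.+1 - i.+1 = m - i)%N by lia.
have -> : (m - i = (m - i.+1).+1)%N by lia.
rewrite !exprS; ring.
Qed.

Lemma qfactS m : qfact m.+1 = qfact m * (1 - 'X^(m.+1)).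
Proof. by rewrite /qfact big_ord_recr. Qed.

(** The quotient formula for Gaussian binomials, free of divisions. *)
Lemma qbin_fact m i : (i <= m)%N ->
  qbin m i * qfact i * qfact (m - i) = qfact m.
Proof.
elim: m i => [|m IH] [|i] im //; rewrite ?qbin0 ?subn0.
- by rewrite /qfact big_ord0 !mulr1.
- by rewrite {1}/qfact big_ord0 !mul1r.
have IHi : qbin m i * qfact i * qfact (m - i) = qfact m by apply: IH; lia.
rewrite qbinS subSS 2!mulrDl.
case: (ltnP i m) => [lt_im|le_mi]; last first.
  have ei : i = m by lia.
  rewrite (@qbin_small m i.+1) ?ei // mulr0 !mul0r addr0 qfactS.
  by rewrite -[in RHS](IH m) //; ring.
have {IH}IHS := IH i.+1 lt_im.
have E : (m - i = (m - i.+1).+1)%N by lia.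
rewrite [in X in _ + X]E [qfact (m - i.+1).+1]qfactS -E [qfact m.+1]qfactS.
have -> : 'X^(m.+1) = 'X^(i.+1) * 'X^(m - i) :> {poly R}.
  by rewrite -exprD; congr ('X^_); lia.
transitivity (qfact m * (1 - 'X^(i.+1)) + 'X^(i.+1) * (1 - 'X^(m - i)) * qfact m);
  last by ring.
congr (_ + _); first by rewrite -IHi qfactS; ring.
by rewrite -IHS; ring.
Qed.

(** Each q-Pascal rule moves a weighted sum along row m.+1 to one along row m. Here
the weights are arbitrary, and the end terms fit because qbin m m.+1 = 0. *)
Lemma sum_qbinS m (w : nat -> {poly R}) :
  \sum_(i < m.+2) w i * qbin m.+1 i =
  \sum_(i < m.+1) (w i.+1 + w i * 'X^i) * qbin m i.
Proof.
rewrite big_ord_recl /= qbin0 mulr1.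
under eq_bigr => i _ do rewrite qbinS mulrDr.
rewrite big_split /=.
under [in RHS]eq_bigr => i _ do rewrite mulrDl.
rewrite [in RHS]big_split /= [X in _ = _ + X]big_ord_recl /= qbin0 expr0 !mulr1.
rewrite [X in _ + (_ + X)]big_ord_recr /= qbin_small // !mulr0 addr0.
rewrite addrCA; congr (_ + (_ + _)); apply: eq_bigr => i _.
by rewrite /bump /= mulrA.
Qed.

Lemma sum_qbinS_dual m (w : nat -> {poly R}) :
  \sum_(i < m.+2) w i * qbin m.+1 i =
  \sum_(i < m.+1) (w i.+1 * 'X^(m - i) + w i) * qbin m i.
Proof.
rewrite big_ord_recl /= qbin0 mulr1.
have -> : \sum_(i < m.+1) w (bump 0 i) * qbin m.+1 (bump 0 i) =
  \sum_(i < m.+1) (w i.+1 * 'X^(m - i) * qbin m i + w i.+1 * qbin m i.+1).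
  apply: eq_bigr => i _; rewrite /bump add1n qbinS_dual ?mulrDr ?mulrA //.
  by have := ltn_ord i; lia.
rewrite big_split /=.
under [in RHS]eq_bigr => i _ do rewrite mulrDl.
rewrite [in RHS]big_split /= [X in _ = _ + X]big_ord_recl /= qbin0 !mulr1.
rewrite [X in _ + (_ + X)]big_ord_recr /= qbin_small // !mulr0 addr0.
by rewrite addrCA.
Qed.

Definition theta_term (m : nat) : {poly R} := (-1) ^+ m * 'X^(m ^ 2).

(** The truncation of Q(q) = (q; q^2). *)
Definition odd_qprod (n : nat) : {poly R} := \prod_(i < n) (1 - 'X^(i.*2.+1)).

Lemma odd_qprodS n : odd_qprod n.+1 = odd_qprod n * (1 - 'X^(n.*2.+1)).
Proof. by rewrite /odd_qprod big_ord_recr. Qed.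

Lemma sign_dist (i n : nat) :
  (-1) ^+ `|i - n|%N = (-1) ^+ i * (-1) ^+ n :> {poly R}.
Proof.
rewrite -exprD -signr_odd -[in RHS]signr_odd; congr (_ ^+ _); congr nat_of_bool.
by lia.
Qed.

(** Induction on n through two rows of the q-Pascal triangle. With j = i - n, the
weights that reach the entry i of row 2n are those of j - 1, j and j + 1:
  q^(j^2) (1 + q^(n+j+1)) - q^((j+1)^2 + n - j) - q^((j-1)^2 + 2n + 2j),
where the third exponent is j^2 + 2n + 1 and the second, j^2 + n + j + 1, cancels.
What remains is q^(j^2) (1 - q^(2n+1)). *)
Lemma gauss_finite n :
  \sum_(i < n.*2.+1) theta_term `|i - n|%N * qbin n.*2 i = odd_qprod n.
Proof.
elim: n => [|n IH].
  rewrite big_ord_recl !big_ord0 /= /odd_qprod big_ord0 /theta_term /=.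
  by rewrite qbin0 !expr0 !mulr1 addr0.
(* Of the two halves produced by one rule, the first is lowered by the dual rule
   and the second by the same rule; otherwise the terms would not cancel. *)
rewrite doubleS (sum_qbinS n.*2.+1 (fun i => theta_term `|i - n.+1|%N)).
under eq_bigr => i _ do rewrite mulrDl.
rewrite big_split /=.
rewrite (sum_qbinS_dual _ (fun i => theta_term `|i.+1 - n.+1|%N)).
rewrite (sum_qbinS _ (fun i => theta_term `|i - n.+1|%N * 'X^i)).
rewrite odd_qprodS -IH mulr_suml -big_split /=.
apply: eq_bigr => i _; have le_i : (i <= n.*2)%N by have := ltn_ord i; lia.
rewrite -mulrDl [RHS]mulrAC; congr (_ * _).
rewrite /theta_term !sign_dist !exprS.
have d (a b : nat) : `|a.+1 - b.+1|%N = `|a - b|%N by exact: (distnDl 1).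
rewrite !d.
have e1 : 'X^(`|i.+1 - n|%N ^ 2) * 'X^(n.*2 - i) =
          'X^(`|i - n|%N ^ 2) * 'X^(i.+1) :> {poly R}.
  by rewrite -!exprD; congr ('X^_); have := (sqrn_dist i.+1 n, sqrn_dist i n); nia.
have e2 : 'X^(`|i - n.+1|%N ^ 2) * 'X^i * 'X^i =
          'X^(`|i - n|%N ^ 2) * 'X^(n.*2.+1) :> {poly R}.
  by rewrite -!exprD; congr ('X^_); have := (sqrn_dist i n.+1, sqrn_dist i n); nia.
rewrite !exprS in e1 e2 *.
set s := (-1) ^+ i; set t := (-1) ^+ n.
rewrite (_ : _ * 'X^(n.*2 - i) = - s * t * ('X^(`|i - n|%N ^ 2) * ('X * 'X^i)));
  last by rewrite -e1; ring.
rewrite (_ : _ * 'X^i * 'X^i = - s * t * ('X^(`|i - n|%N ^ 2) * ('X * 'X^(n.*2))));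
  last by rewrite -e2; ring.
by ring.
Qed.

End GaussianBinomials.

(** * Gauss's product for the theta series *)

Section Theta.
Variable R : comNzRingType.

Definition theta (n : nat) : {poly R} :=
  1 + (\sum_(1 <= m < n.+1) theta_term R m) *+ 2.

Lemma sum_dist (V : nmodType) (F : nat -> V) n :
  \sum_(i < n.*2.+1) F `|i - n|%N = F 0%N + (\sum_(1 <= m < n.+1) F m) *+ 2.
Proof.
rewrite -addnn -addnS big_split_ord /= addrC big_ord_recl /=.
rewrite addn0 distnn -addrA; congr (_ + _).
rewrite big_add1 /= big_mkord mulr2n; congr (_ + _).
  apply: eq_bigr => i _; congr F; rewrite /bump /=; lia.
rewrite (reindex_inj rev_ord_inj); apply: eq_bigr => i _; congr F => /=.
by have := ltn_ord i; lia.
Qed.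

Lemma thetaE n : theta n = \sum_(i < n.*2.+1) theta_term R `|i - n|%N.
Proof. by rewrite sum_dist /theta /theta_term !expr0 mulr1. Qed.

Lemma qfact_coef0 n : (qfact R n)`_0 = 1.
Proof.
elim: n => [|n IH]; first by rewrite /qfact big_ord0 coef1.
by rewrite qfactS coef0M IH mul1r coefB coef1 coefXn subr0.
Qed.

Lemma eqmodX_qfact N n : (N <= n)%N ->
  eqmodX N.+1 (qfact R n) (qfact R N).
Proof.
move=> Nn; apply: (eqmodX_prod_widen (F := fun i => 1 - 'X^(i.+1))) => // i iN.
by apply: eqmodX_1subXn; lia.
Qed.

(** As (q; q)_m, (q; q)_i and (q; q)_(m-i) agree with (q; q)_N below degree N.+1, the
quotient formula reduces to E * E * qbin = E, with E the unit (q; q)_N. *)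
Lemma eqmodX_qbin N m i : (N <= i)%N -> (N + i <= m)%N ->
  eqmodX N.+1 (qfact R N * qbin R m i) 1.
Proof.
move=> Ni Nim; apply: (eqmodX_cancel (qfact_coef0 N)); rewrite mulr1.
have E : eqmodX N.+1 (qfact R m) (qfact R N) by apply: eqmodX_qfact; lia.
apply: (eqmodX_trans _ E); rewrite -(@qbin_fact R m i); last by lia.
rewrite mulrA mulrC mulrA; apply: eqmodXM; last first.
  by apply: eqmodX_sym; apply: eqmodX_qfact; lia.
apply: eqmodXM => //; apply: eqmodX_sym; exact: eqmodX_qfact.
Qed.

(** The finite identity multiplied by (q; q)_N: for |j| <= N the binomials become 1,
and for |j| > N the terms on both sides are 0 modulo 'X^N.+1 since j^2 > N. *)
Lemma theta_gauss N n : (N.*2 <= n)%N ->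
  eqmodX N.+1 (theta n) (qfact R N * odd_qprod R n).
Proof.
move=> Nn; rewrite thetaE -gauss_finite mulr_sumr; apply: eqmodX_sum => i _.
have := ltn_ord i; set d := `|i - n|%N => lt_i.
rewrite mulrCA; case: (leqP d N) => dN.
  rewrite -[X in eqmodX _ X]mulr1; apply: eqmodXM => //.
  by apply/eqmodX_sym/eqmodX_qbin; rewrite /d in dN; lia.
have d0 : eqmodX N.+1 (theta_term R d) 0.
  by apply: eqmodX_Xn; apply: (leq_trans dN);
  rewrite -[X in (X <= _)%N]expn1 leq_pexp2l // (leq_ltn_trans _ dN).
apply: (eqmodX_trans d0); rewrite -[X in eqmodX _ X](mul0r (qfact R N * qbin R n.*2 i)).
by apply: eqmodXM => //; apply: eqmodX_sym.
Qed.

(** The truncation of V(q) = (q^2; q^2). *)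
Definition even_qprod (n : nat) : {poly R} := \prod_(i < n) (1 - 'X^(i.+1.*2)).

Lemma even_qprodS n : even_qprod n.+1 = even_qprod n * (1 - 'X^(n.+1.*2)).
Proof. by rewrite /even_qprod big_ord_recr. Qed.

Lemma qfact_double n : qfact R n.*2 = odd_qprod R n * even_qprod n.
Proof.
elim: n => [|n IH]; first by rewrite /qfact /odd_qprod /even_qprod !big_ord0 mulr1.
rewrite doubleS !qfactS IH odd_qprodS even_qprodS doubleS; ring.
Qed.

Lemma eqmodX_odd_qprod n m : (m <= n)%N ->
  eqmodX m.*2.+1 (odd_qprod R n) (odd_qprod R m).
Proof.
move=> mn; apply: (eqmodX_prod_widen (F := fun i => 1 - 'X^(i.*2.+1))) => // i im.
by apply: eqmodX_1subXn; lia.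
Qed.

Lemma comp_qfact_X2 n : qfact R n \Po 'X^2 = even_qprod n.
Proof.
rewrite /qfact rmorph_prod; apply: eq_bigr => i _ /=.
by rewrite comp_polyB comp_polyC comp_Xn_poly -exprM mul2n.
Qed.

Lemma eqmodX_even_qprod n m : (m <= n)%N ->
  eqmodX m.*2.+1 (even_qprod n) (even_qprod m).
Proof.
move=> mn; apply: (eqmodX_prod_widen (F := fun i => 1 - 'X^(i.+1.*2))) => // i im.
by apply: eqmodX_1subXn; lia.
Qed.

(** 1 - q^(2i) = (1 - q^i)(1 + q^i), and 1 + q^i is 1 - q^i at -q for i odd. *)
Lemma comp_odd_qprod_X2 n : odd_qprod R n \Po 'X^2 = odd_qprod R n * (odd_qprod R n \Po (- 'X)).
Proof.
rewrite /odd_qprod !rmorph_prod -big_split; apply: eq_bigr => i _ /=.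
rewrite !comp_polyB !comp_polyC !comp_Xn_poly -exprM mul2n -addnn exprD.
rewrite (exprNn 'X) -signr_odd /= odd_double expr1; ring.
Qed.

Lemma theta_X_prod M n : (M.*2.*2 <= n)%N ->
  eqmodX M.*2.+1 (theta n) (odd_qprod R M * even_qprod M * odd_qprod R M).
Proof.
move=> Mn; apply: (eqmodX_trans (theta_gauss Mn)).
by rewrite qfact_double; apply: eqmodXM => //; apply: eqmodX_odd_qprod; lia.
Qed.

Lemma theta_X2_prod M n : (M.*2.*2 <= n)%N ->
  eqmodX M.*2.+1 (theta n \Po 'X^2) (odd_qprod R M * even_qprod M * (odd_qprod R M \Po (- 'X))).
Proof.
move=> Mn; have h := eqmodX_comp_Xn (isT : (0 < 2)%N) (theta_X_prod Mn).
apply: (eqmodX_trans h); rewrite comp_polyM -[in X in eqmodX _ X _]qfact_double.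
rewrite comp_qfact_X2 comp_odd_qprod_X2 mulrCA mulrA; apply: eqmodXM => //; apply: eqmodXM => //.
by apply: eqmodX_even_qprod; lia.
Qed.

(** * Even polynomials *)

Lemma coef_comp_NX (p : {poly R}) i : (p \Po (- 'X))`_i = (-1) ^+ i * p`_i.
Proof.
elim/poly_ind: p i => [|p c IH] i; first by rewrite comp_poly0 !coef0 mulr0.
rewrite comp_poly_MXaddC !coefD mulrN coefN !coefMX !coefC IH.
by case: i => [|i] /=; rewrite ?exprS; ring.
Qed.

Lemma coef_even_comp_NX (H p : {poly R}) n : H \Po (- 'X) = H -> ~~ odd n ->
  (H * (p \Po (- 'X)))`_n = (H * p)`_n.
Proof.
move=> eH /negbTE n_even.
by rewrite -{1}eH -comp_polyM coef_comp_NX -signr_odd n_even mul1r.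
Qed.

End Theta.

(** * The generating function of a k *)

Section PartitionSeries.
Variables (R : comNzRingType) (k : nat).

(** The factor of the part i.+1 when j.+1 is distinguished: a multiplicity counts with
weight 1, except for the distinguished part, which counts with its multiplicity. *)
Definition part_gf (j i : nat) : {poly R} :=
  \sum_(m < k) (if i == j then m : nat else 1%N)%:R *: 'X^(m * i.+1).

Definition parts_gf (N : nat) : {poly R} :=
  \sum_(j < N | (k %| j.+1)%N) \prod_(i < N) part_gf j i.

Lemma part_gf_other j i n : (0 < k)%N -> i != j -> (n <= i)%N ->
  eqmodX n.+1 (part_gf j i) 1.
Proof.
move=> k0 /negbTE ij ni; rewrite /part_gf ij; case: k k0 => // l _.
rewrite big_ord_recl /= mul0n expr0 scale1r -[X in eqmodX _ _ X]addr0.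
apply: eqmodXD => //; apply: eqmodX_sum0 => m _.
rewrite scale1r -['X^_]mul1r; apply: eqmodX_Xn.
by rewrite /bump /=; nia.
Qed.

Lemma part_gf_marked j n : (n <= j)%N -> eqmodX n.+1 (part_gf j j) 0.
Proof.
move=> nj; rewrite /part_gf eqxx.
apply: eqmodX_sum0 => m _; case: (posnP m) => [->|m0]; first by rewrite scale0r.
by rewrite -mul_polyC; apply: eqmodX_Xn; nia.
Qed.

(** The coefficient of degree n sees only parts of size at most n: larger parts have
factor 1 up to degree n, or 0 when distinguished. *)
Lemma parts_gf_stable n N : (0 < k)%N -> (n <= N)%N ->
  eqmodX n.+1 (parts_gf N) (parts_gf n).
Proof.
move=> k0 nN; rewrite {2}/parts_gf.
rewrite (big_ord_widen_cond N (fun j => (k %| j.+1)%N)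
  (fun j => \prod_(i < n) part_gf j i)) //.
rewrite /parts_gf big_mkcond [X in eqmodX _ _ X]big_mkcond /=.
apply: eqmodX_sum => j _; case: ifP => //= _; case: ltnP => jn.
  apply: (eqmodX_prod_widen (F := part_gf j)) => // i /andP[ni _].
  by apply: part_gf_other => //; lia.
rewrite (bigD1 j) //= -(mul0r (\prod_(i < N | i != j) part_gf j i)).
by apply: eqmodXM => //; apply: part_gf_marked.
Qed.

(** This brings the range of multiplicities to 'I_n.+1, the one used in partitions n. *)
Lemma part_gf_trunc j i n : eqmodX n.+1 (part_gf j i)
  (\sum_(m < n.+1)
     (if (m < k)%N then (if i == j then m : nat else 1%N)%:R *: 'X^(m * i.+1)
      else 0)).
Proof.
pose f m : {poly R} := (if i == j then m else 1%N)%:R *: 'X^(m * i.+1).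
have -> : part_gf j i = \sum_(m < k + n.+1 | (m < k)%N) f m.
  by rewrite -(big_ord_widen _ f) // leq_addr.
rewrite -big_mkcond /= (@big_ord_widen_cond _ _ _ n.+1 (k + n.+1) (fun m => (m < k)%N) f);
  last by rewrite leq_addl.
rewrite big_mkcond [X in eqmodX _ _ X]big_mkcond; apply: eqmodX_sum => m _.
case: (ltnP m k) => //= _; case: ltnP => // nm.
by rewrite /f -mul_polyC; apply: eqmodX_Xn; nia.
Qed.

(** Distributing the product over the sums of multiplicities gives one monomial
for each family mu, of degree the size of mu and of weight mu j. *)
Lemma coef_parts_gf_diag n : (parts_gf n)`_n = (a k n)%:R.
Proof.
rewrite /parts_gf coef_sum /a [in RHS]exchange_big /= natr_sum.
apply: eq_bigr => j _.
rewrite (eqmodX_prod _ (fun (i : 'I_n) _ => @part_gf_trunc j i n)) //.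
rewrite bigA_distr_bigA coef_sum natr_sum [RHS]big_mkcond /=.
apply: eq_bigr => mu _; rewrite inE.
case: (boolP [forall i, mu i < k]%N) => [/forallP mu_lt|]; last first.
  rewrite negb_forall => /existsP[i /negbTE mu_i].
  by rewrite andbF (bigD1 i) //= mu_i mul0r coef0.
rewrite andbT; under eq_bigr => i _ do rewrite mu_lt -mul_polyC.
rewrite big_split /= -rmorph_prod /= -natr_prod -expr_sum coefCM coefXn.
rewrite [n == _]eq_sym; case: eqP => _; last by rewrite mulr0.
rewrite mulr1 (bigD1 j) //= eqxx big1 ?muln1 // => i.
by rewrite -val_eqE /= => /negbTE->.
Qed.

Lemma coef_parts_gf n N : (0 < k)%N -> (n <= N)%N ->
  (parts_gf N)`_n = (a k n)%:R.
Proof. by move=> k0 nN; rewrite -coef_parts_gf_diag (parts_gf_stable k0 nN). Qed.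

Lemma part_gf_odd_index j i : odd i -> part_gf j i \Po (- 'X) = part_gf j i.
Proof.
move=> i_odd; rewrite rmorph_sum; apply: eq_bigr => m _ /=.
rewrite comp_polyZ comp_Xn_poly exprNn -signr_odd oddM /= i_odd andbF.
by rewrite mul1r.
Qed.

Lemma part_gf_mul_1subX j i : ~~ odd k -> i != j ->
  (part_gf j i * (1 - 'X^(i.+1))) \Po (- 'X) = part_gf j i * (1 - 'X^(i.+1)).
Proof.
move=> k_even /negbTE ij.
have -> : part_gf j i * (1 - 'X^(i.+1)) = 1 - 'X^(i.+1 * k).
  rewrite /part_gf ij exprM -[RHS]opprB subrX1 -mulNr opprB mulrC.
  by congr (_ * _); apply: eq_bigr => m _; rewrite scale1r mulnC exprM.
rewrite comp_polyB comp_polyC comp_Xn_poly exprNn -signr_odd oddM.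
by rewrite (negbTE k_even) andbF mul1r.
Qed.

Lemma prod_pairs (F : nat -> {poly R}) M :
  \prod_(i < M.*2) F i = \prod_(i < M) (F i.*2 * F i.*2.+1).
Proof.
elim: M => [|M IH]; first by rewrite !big_ord0.
by rewrite doubleS !big_ord_recr /= IH mulrA.
Qed.

(** The factors are grouped by pairs of parts 2i+1, 2i+2, with 1 - 'X^(2i+1) from
odd_qprod. A multiple of k is even, so the distinguished part is never 2i+1. *)
Lemma parts_gf_odd_qprod_even M : ~~ odd k ->
  (parts_gf M.*2 * odd_qprod R M) \Po (- 'X) = parts_gf M.*2 * odd_qprod R M.
Proof.
move=> k_even; rewrite /parts_gf mulr_suml rmorph_sum; apply: eq_bigr => j kj.
have j_odd : odd j.
  apply/negPn/negP => j_even.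
  have : odd j.+1 by rewrite /= j_even.
  by case/dvdnP: kj => q ->; rewrite oddM (negbTE k_even) andbF.
rewrite (prod_pairs (part_gf j)) /odd_qprod -big_split /= rmorph_prod.
apply: eq_bigr => i _ /=; rewrite mulrAC comp_polyM part_gf_odd_index ?oddS ?odd_double //.
congr (_ * _); apply: part_gf_mul_1subX => //.
by apply: contraTneq j_odd => <-; rewrite odd_double.
Qed.

End PartitionSeries.

(** * The coefficients of A(q) T(q) and A(q) T(q^2) *)

Lemma coef_mul_theta_term (R : comNzRingType) (p : {poly R}) c m N :
  (p * (theta_term R m \Po 'X^c))`_N =
  if (N < c * m ^ 2)%N then 0 else (-1) ^+ m * p`_(N - c * m ^ 2).
Proof.
have -> : theta_term R m \Po 'X^c = ((-1) ^+ m)%:P * 'X^(c * m ^ 2).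
  by rewrite /theta_term comp_polyM comp_Xn_poly -exprM !rmorph_sign.
by rewrite mulrCA coefCM coefMXn; case: ifP => //; rewrite mulr0.
Qed.

(** The range of summation of the theorem appears here as the set of the m for which
'X^(c * m ^ 2) can contribute to degree N. *)
Lemma coef_parts_gf_theta (k N n s c : nat) : (0 < k)%N -> (s <= n)%N ->
    (forall m, (m <= s)%N = (c * m ^ 2 <= N)%N) ->
  (parts_gf int k N * (theta int n \Po 'X^c))`_N =
  (a k N)%:Z - (\sum_(1 <= m < s.+1)
      (-1) ^+ (m - 1)%N * (a k (N - c * m ^ 2))%:Z) *+ 2.
Proof.
move=> k0 sn sP; rewrite /theta rmorphD rmorphMn rmorph_sum rmorph1 /=.
rewrite mulrDr mulr1 coefD coef_parts_gf // natz; congr (_ + _).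
rewrite mulrnAr coefMn -mulNrn; congr (_ *+ 2).
rewrite mulr_sumr coef_sum (@big_cat_nat _ _ _ s.+1) //= addrC big1_seq ?add0r.
  rewrite -sumrN; apply: eq_big_nat => m /andP[m1 ms].
  rewrite coef_mul_theta_term ltnNge -sP (ltnSE ms) /=.
  rewrite coef_parts_gf ?leq_subr // natz.
  by case: m m1 {ms} => // m _; rewrite subn1 exprS mulN1r mulNr.
move=> m /=; rewrite mem_index_iota => /andP[sm _].
by rewrite coef_mul_theta_term ltnNge -sP -ltnNge sm.
Qed.

Theorem theorem6p4 (k n : nat) (k_ge2 : (2 <= k)%N)
    (k_even : ~~ odd k) (n_even : ~~ odd n) :
  \sum_(1 <= m < (Nat.sqrt n).+1)
      (-1) ^+ (m - 1)%N * (a k (n - m ^ 2))%:Z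
  = \sum_(1 <= m < (Nat.sqrt (n %/ 2)).+1)
      (-1) ^+ (m - 1)%N * (a k (n - 2 * m ^ 2))%:Z.
Proof.
have sqrtP N m : (m <= Nat.sqrt N)%N = (m ^ 2 <= N)%N.
  by apply/leP/leP => [/Nat.sqrt_le_square|h]; last apply/Nat.sqrt_le_square.
have sqrt_le N : (Nat.sqrt N <= N)%N.
  by have := sqrtP N (Nat.sqrt N); rewrite leqnn; nia.
set s1 := Nat.sqrt n; set s2 := Nat.sqrt (n %/ 2).
(* M pairs of parts cover all parts up to n, and t is large enough for the theta
   series to be exact up to degree n. *)
pose M := n./2; pose t := n.*2.
have nM : n = M.*2 by rewrite /M; lia.
have k0 : (0 < k)%N by lia.
have h1 := @coef_parts_gf_theta k n t s1 1 k0.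
have h2 := @coef_parts_gf_theta k n t s2 2 k0.
pose H : {poly int} := parts_gf int k n * odd_qprod int M * even_qprod int M.
have H_even : H \Po (- 'X) = H.
  rewrite /H comp_polyM nM parts_gf_odd_qprod_even //; congr (_ * _).
  rewrite rmorph_prod; apply: eq_bigr => i _ /=.
  rewrite comp_polyB comp_polyC comp_Xn_poly exprNn -signr_odd odd_double.
  by rewrite mul1r.
have E : (parts_gf int k n * (theta int t \Po 'X^1))`_n =
         (parts_gf int k n * (theta int t \Po 'X^2))`_n.
  have Mt : (M.*2.*2 <= t)%N by rewrite /t; lia.
  rewrite expr1 comp_polyXr.
  rewrite (eqmodXM (eqmodX_refl _) (theta_X_prod int Mt)) -?nM //.
  rewrite (eqmodXM (eqmodX_refl _) (theta_X2_prod int Mt)) -?nM //.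
  by rewrite !mulrA -/H (coef_even_comp_NX _ H_even).
rewrite h1 in E; last first.
- by move=> m; rewrite mul1n sqrtP.
- by have := sqrt_le n; rewrite /t /s1; lia.
rewrite h2 in E; last first.
- by move=> m; rewrite sqrtP leq_divRL // mulnC.
- by have := sqrt_le (n %/ 2)%N; rewrite /t /s2; lia.
move: E; under eq_bigr => m _ do rewrite mul1n.
have two_inj (x y z : int) : x - y *+ 2 = x - z *+ 2 -> y = z by lia.
exact: two_inj.
Qed.
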